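(* Let $p$ be an odd prime and let $x\ge 3$ be an integer. The number of powerful $p$-groups of rank $2$ and order $p^x$, up to isomorphism, is $$\begin{array}{ll} \dfrac{x^3+12x^2+12x}{72} & \text{if } x\equiv 0\pmod 6,\\[2mm] \dfrac{x^3+12x^2+3x-16}{72} & \text{if } x\equiv 1\pmod 6,\\[2mm] \dfrac{x^3+12x^2+12x-8}{72} & \text{if } x\equiv 2\pmod 6,\\[2mm] \dfrac{x^3+12x^2+3x}{72} & \text{if } x\equiv 3\pmod 6,\\[2mm] \dfrac{x^3+12x^2+12x-16}{72} & \text{if } x\equiv 4\pmod 6,\\[2mm] \dfrac{x^3+12x^2+3x-8}{72} & \text{if } x\equiv 5\pmod 6. \end{array}$$
   Context: A finite $p$-group $G$ is powerful if $[G,G]\le G^p$, where $G^p$ is the subgroup generated by all $p$-th powers. The rank of a powerful $p$-group is its minimal number of generators, so rank $2$ means generated by two elements but not cyclic. Abelian groups are included in the count. *)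

(* Defs.v *)
From mathcomp Require Import all_boot all_order all_algebra all_fingroup all_solvable.
Set Implicit Arguments.
Unset Strict Implicit.
Unset Printing Implicit Defensive.
Import GroupScope.

(* For a p-group G, the right-hand side is 'Mho^1(G) by MhoE. *)
Definition powerful (p : nat) (gT : finGroupType) (G : {group gT}) : bool :=
  [~: G, G] \subset <<[set g ^+ p | g in G]>>.

(* The rank is the minimal number of generators 'm(G), not the p-rank 'r(G)
   (maximal rank of an elementary abelian subgroup). *)
Definition powerful_rank2 (p x : nat) (gT : finGroupType) (G : {group gT}) : Prop :=
  [/\ p.-group G, #|G| = (p ^ x)%N, powerful p G & 'm(G) = 2].

(* The finite groups satisfying P form exactly n isomorphism classes:
   G 0, ..., G n.-1 is a complete irredundant list of representatives. *)
Definition num_isog_classes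
    (P : forall gT : finGroupType, {group gT} -> Prop) (n : nat) : Prop :=
  exists (gT : 'I_n -> finGroupType) (G : forall i : 'I_n, {group gT i}),
    [/\ forall i : 'I_n, P (gT i) (G i),
        forall i j : 'I_n, G i \isog G j -> i = j
      & forall (hT : finGroupType) (H : {group hT}),
          P hT H -> exists i : 'I_n, H \isog G i].

(* Main.v *)
Require Import Defs.
From mathcomp Require Import all_boot all_order all_algebra all_fingroup all_solvable.
From mathcomp Require Import zify ring lra.
Set Implicit Arguments.
Unset Strict Implicit.
Unset Printing Implicit Defensive.

(* In a powerful 2-generator p-group G with p odd, G' is contained in <d> for some d outside Phi(G): modulo Phi(G') the derived subgroup is central and cyclic of order at most p, hence the p-th power map is a morphism with image Phi(G), and an element d of maximal order with G' <= <d> is not a p-th power. Hence G is metacyclic. Choosing d of minimal order leads to the normal form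
     a^(p^m) = 1, b^(p^n) = a^(p^l), a^b = a^(1 + p^r),  1 <= r <= l <= n, l <= m <= l + r,
   with |G| = p^(m + n). Every such (m, n, l, r) is realised, and the parameters are recovered from |G|, |G'| = p^(m - r), exp(G / G') = p^n and exp(G) = p^(n + m - l). Writing u = m - l, v = r - u, s = l - r, t = n - l, one is left with counting the solutions of 3 u + 2 v + 2 s + t = x with u + v > 0. *)

Local Open Scope nat_scope.

(** * Geometric sums and one-units modulo prime powers *)

Lemma sum_geom_mul k m n :
  \sum_(i < m * n) k ^ i = (\sum_(i < m) k ^ i) * \sum_(j < n) (k ^ m) ^ j.
Proof.
elim: n => [|n IHn]; first by rewrite muln0 !big_ord0 muln0.
rewrite mulnS addnC big_split_ord /= IHn big_ord_recr /= mulnDr; congr (_ + _).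
by rewrite big_distrl /=; apply: eq_bigr => i _; rewrite expnD -expnM mulnC.
Qed.

Lemma expn_succ_order2 z j : exists t, (1 + z) ^ j = 1 + j * z + z * z * t.
Proof.
elim: j => [|j [t IHj]]; first by exists 0; lia.
by exists (j + t + z * t); rewrite expnS IHj; ring.
Qed.

Lemma sum_geom_order2 z n :
  exists t, \sum_(j < n) (1 + z) ^ j = n + 'C(n, 2) * z + z * z * t.
Proof.
elim: n => [|n [t IHn]]; first by exists 0; rewrite big_ord0 bin0n muln0.
have [u Hu] := expn_succ_order2 z n.
by exists (t + u); rewrite big_ord_recr /= IHn Hu binS bin1; ring.
Qed.

(** The sum of length [p ^ n.+1] factors as the one of length [p ^ n] times a sum of [p] powers of
    some [1 + u * p]. The latter is [p] times a number congruent to 1 modulo [p], because for odd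
    [p] the coefficient ['C(p, 2)] is a multiple of [p]. *)
Lemma sum_geom_prime_power p z n : prime p -> odd p ->
  exists t, \sum_(i < p ^ n) (1 + z * p) ^ i = p ^ n * (1 + t * p).
Proof.
move=> p_pr p_odd; elim: n => [|n [t IHn]].
  by exists 0; rewrite big_ord1.
have [u kn] : exists u, (1 + z * p) ^ (p ^ n) = 1 + u * p.
  have [u ->] := expn_succ_order2 (z * p) (p ^ n).
  by exists (p ^ n * z + z * p * z * u); ring.
have [v sum_p] := sum_geom_order2 (u * p) p.
have [h Dp] : exists h, p = 1 + 2 * h by exists p./2; lia.
have Cp : 'C(p, 2) = p * h by rewrite bin2 {2}Dp /= mulnCA mul2n doubleK.
exists (t + (h * u + u * u * v) * (1 + t * p)).
by rewrite expnSr sum_geom_mul IHn kn sum_p Cp; ring.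
Qed.

(** Comes from [k ^ N - 1 = (k - 1) * \sum_(i < N) k ^ i], written without subtraction. *)
Lemma expn_succ_prime_power p z n : prime p -> odd p ->
  exists t, (1 + z * p) ^ (p ^ n) = 1 + z * p * (p ^ n * (1 + t * p)).
Proof.
move=> p_pr p_odd; have [t sum_pn] := sum_geom_prime_power z n p_pr p_odd.
exists t; rewrite -sum_pn; elim: (p ^ n) => [|m IHm].
  by rewrite big_ord0 muln0.
rewrite big_ord_recr [LHS]expnS /= mulnDr addnA -IHm.
by ring.
Qed.

(* The units congruent to 1 modulo p^r form a cyclic group modulo p^(r + m), so every k = 1 + p^r w with w prime to p has 1 + p^r among its powers. *)
Lemma one_units_log p r w m : prime p -> odd p -> coprime p w ->
  exists c z, 0 < c /\ (1 + p ^ r.+1 * w) ^ c = 1 + p ^ r.+1 + p ^ (r.+1 + m) * z.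
Proof.
move=> p_pr p_odd co_pw; have p_gt0 := prime_gt0 p_pr.
have w_gt0 : 0 < w.
  by case: w co_pw => //; rewrite /coprime gcdn0 => /eqP p1; rewrite p1 in p_pr.
elim: m => [|m [c [z [c_gt0 IHm]]]].
  exists 1, w.-1; split=> //; rewrite addn0 expn1.
  by rewrite -{1}(prednK w_gt0); ring.
have [t kpm] := expn_succ_prime_power (p ^ r * w) m p_pr p_odd.
pose u := w * (1 + t * p).
have kpm' : (1 + p ^ r.+1 * w) ^ (p ^ m) = 1 + p ^ (r.+1 + m) * u.
  have ->: p ^ r.+1 * w = p ^ r * w * p by rewrite expnS; ring.
  by rewrite kpm /u expnD expnS; ring.
have co_pu : gcdn p u = 1.
  apply/eqP; rewrite -/(coprime p u) coprimeMr co_pw /coprime.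
  by rewrite [1 + _]addnC gcdnMDl gcdn1.
(* Here [p] divides [1 + a * u]. With [k = 1 + p ^ r.+1 * w], multiplying by [k ^ (p ^ m * (z * a))]
   changes the error coefficient [z] into [z * (1 + a * u)] modulo [p], that is, into 0. *)
have [a _] := Bezoutl u p_gt0; rewrite co_pu => /dvdnP[b Hb].
have [v kpmy] := expn_succ_order2 (p ^ (r.+1 + m) * u) (z * a).
exists (c + p ^ m * (z * a)).
pose y := z * a; pose q := p ^ (r + m).
exists (z * b + q * z * y * u + p ^ r * y * u
        + (1 + p ^ r.+1 + p * q * z) * q * u * u * v).
split; first by rewrite addn_gt0 c_gt0.
rewrite expnD IHm expnM kpm' kpmy.
have ->: p ^ (r.+1 + m.+1) = p * p * q by rewrite addSn addnS !expnS mulnA.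
have ->: p ^ (r.+1 + m) = p * q by rewrite addSn expnS.
have Hz : z + y * u = z * b * p.
  by rewrite -mulnA -Hb mulnDr muln1 mulnA.
transitivity (1 + p ^ r.+1 + p * q * (z + y * u) + p * q * z * (y * (p * q * u))
   + p ^ r.+1 * y * p * q * u + (1 + p ^ r.+1 + p * q * z) * (p * q * u * (p * q * u) * v)).
  by rewrite -/y; ring.
by rewrite Hz expnS; ring.
Qed.

(** If [p] divided [c], the power would be 1 modulo [p ^ r.+1], which [1 + p ^ r] is not.
    Coprimality ensures that raising a [p]-element to the power [c] keeps the cyclic group it
    generates. *)
Lemma one_units_log_coprime p r w m : prime p -> odd p -> coprime p w ->
  0 < r < m ->
  exists c z, coprime p c /\ (1 + p ^ r * w) ^ c = 1 + p ^ r + p ^ m * z.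
Proof.
case: r => // r p_pr p_odd co_pw /= lt_rm; have p_gt0 := prime_gt0 p_pr.
have [c [z [_ kc]]] := one_units_log r (m - r.+1) p_pr p_odd co_pw.
rewrite subnKC 1?ltnW // in kc; exists c, z; split=> //.
rewrite prime_coprime //; apply/negP=> /dvdnP[d Dc].
have [t kp] := expn_succ_prime_power (p ^ r * w) 1 p_pr p_odd.
pose u := w * (1 + t * p).
have {}kp : (1 + p ^ r.+1 * w) ^ p = 1 + p ^ r.+2 * u.
  have ->: p ^ r.+1 * w = p ^ r * w * p by rewrite expnS; ring.
  by rewrite expn1 in kp; rewrite kp /u !expnS; ring.
have [v kpd] := expn_succ_order2 (p ^ r.+2 * u) d.
move: kc; rewrite Dc (mulnC d) expnM kp kpd => /eqP.
rewrite -!addnA eqn_add2l => /eqP E.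
suffices : p ^ r.+2 %| p ^ r.+1 by rewrite dvdn_Pexp2l ?prime_gt1 // ltnn.
have dz : p ^ r.+2 %| p ^ m * z by rewrite dvdn_mulr ?dvdn_exp2l.
rewrite -(dvdn_addl _ dz) -E; move: (p ^ r.+2) => P.
by rewrite -!mulnA mulnCA -mulnDr dvdn_mulr.
Qed.

(** * Counting the parameters *)

(** The unknown [t] of weight one is omitted: it is the slack in [2 * v + 2 * s <= x], and likewise
    in [solutions223]. *)
Definition solutions22 x : seq (nat * nat) :=
  [seq (v, s) | v <- iota 0 x./2.+1, s <- iota 0 (x - v.*2)./2.+1].

Definition solutions223 x : seq (nat * (nat * nat)) :=
  [seq (u, vs) | u <- iota 0 (x %/ 3).+1, vs <- solutions22 (x - 3 * u)].

Lemma mem_solutions22 x v s : ((v, s) \in solutions22 x) = (2 * v + 2 * s <= x).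
Proof.
apply/allpairsPdep/idP => [[v' [s']] | le_x].
  by rewrite !mem_iota => -[Hv Hs [-> ->]]; lia.
by exists v, s; rewrite !mem_iota; split=> //; lia.
Qed.

Lemma mem_solutions223 x u v s :
  ((u, (v, s)) \in solutions223 x) = (3 * u + 2 * v + 2 * s <= x).
Proof.
apply/allpairsPdep/idP => [[u' [[v' s']]] | le_x].
  by rewrite mem_iota mem_solutions22 => -[Hu Hvs [-> -> ->]]; lia.
by exists u, (v, s); rewrite mem_iota mem_solutions22; split=> //; lia.
Qed.

Lemma solutions22_uniq x : uniq (solutions22 x).
Proof. by apply: allpairs_uniq_dep => [|v _|[? ?] [? ?] _ _ [-> ->]]; rewrite ?iota_uniq. Qed.

Lemma solutions223_uniq x : uniq (solutions223 x).
Proof.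
by apply: allpairs_uniq_dep => [|u _|[? ?] [? ?] _ _ [-> ->]]; rewrite ?iota_uniq ?solutions22_uniq.
Qed.

Lemma iota0S n : iota 0 n.+1 = 0 :: [seq i.+1 | i <- iota 0 n].
Proof. by rewrite /= -(iotaDl 1 0). Qed.

Lemma sumn_cons n s : sumn (n :: s) = n + sumn s.
Proof. by []. Qed.

(** Separate the solutions with [v = 0] and lower [v] by one in the others; [size_solutions223D]
    does the same with [u]. *)
Lemma size_solutions22D x :
  size (solutions22 (x + 2)) = x./2.+2 + size (solutions22 x).
Proof.
rewrite !size_allpairs_dep; have -> : (x + 2)./2 = x./2.+1 by lia.
rewrite (iota0S _.+1) map_cons -map_comp sumn_cons size_iota; congr (_ + _).
  by lia.
by apply: (congr1 sumn); apply: eq_map => v; rewrite [LHS]/comp !size_iota; lia.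
Qed.

Lemma size_solutions223D x :
  size (solutions223 (x + 3)) = size (solutions22 (x + 3)) + size (solutions223 x).
Proof.
rewrite [LHS]size_allpairs_dep [size (solutions223 x)]size_allpairs_dep.
have -> : (x + 3) %/ 3 = (x %/ 3).+1 by lia.
rewrite (iota0S _.+1) map_cons -map_comp sumn_cons; congr (_ + _).
  by rewrite muln0 subn0.
apply: (congr1 sumn); apply: eq_map => u; rewrite [LHS]/comp; congr (size (solutions22 _)); lia.
Qed.

Lemma size_solutions22 x : 2 * size (solutions22 x) = x./2.+1 * x./2.+2.
Proof.
rewrite -{1}(odd_double_half x); move: (odd x) x./2 => c k.
elim: k => [|k IHk]; first by case: c.
have -> : c + k.+1.*2 = c + k.*2 + 2 by lia.
rewrite size_solutions22D mulnDr IHk.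
have -> : (c + k.*2)./2 = k by case: c {IHk}; lia.
by nia.
Qed.

Lemma size_solutions223D6 x : size (solutions223 (x + 6)) =
  size (solutions22 (x + 6)) + size (solutions22 (x + 3)) + size (solutions223 x).
Proof.
by rewrite (_ : x + 6 = x + 3 + 3) ?size_solutions223D ?addnA //; lia.
Qed.

(** The count is a cubic quasi-polynomial of period 6: [u] steps by 3 and [size_solutions22] depends
    on parity. The six initial values are computed and the rest follows by steps of 6. *)
Lemma size_solutions223 k c : c < 6 -> let x := 6 * k + c in
  72 * size (solutions223 x) =
  x ^ 3 + 12 * x ^ 2 + (if odd c then 39 else 48) * x + nth 0 [:: 72; 20; 64; 36; 56; 28] c.
Proof.
move=> lt_c6 x; rewrite {}/x; elim: k => [|k IHk].
  by case: c lt_c6 => [|[|[|[|[|[|//]]]]]] _; vm_compute.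
have -> : 6 * k.+1 + c = 6 * k + c + 6 by lia.
rewrite size_solutions223D6 !mulnDr IHk.
have := size_solutions22 (6 * k + c + 6); have := size_solutions22 (6 * k + c + 3).
have E6 : (6 * k + c + 6)./2 = 3 * k + c./2 + 3 by lia.
have E3 : (6 * k + c + 3)./2 = 3 * k + (c + 3)./2 by lia.
rewrite E6 E3; move: (size _) (size _) => s t.
case: c lt_c6 {IHk E6 E3} => [|[|[|[|[|[|//]]]]]] _ /=; rewrite ?expnS ?expn0; nia.
Qed.

(** The filter expresses [r > 0], since [r = u + v]. *)
Definition metacyclic_params x : seq (nat * (nat * nat)) :=
  [seq t <- solutions223 x | 0 < t.1 + t.2.1].

Lemma size_metacyclic_params x :
  size (metacyclic_params x) + x./2.+1 = size (solutions223 x).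
Proof.
have /perm_size <- : perm_eq (metacyclic_params x ++ [seq (0, (0, s)) | s <- iota 0 x./2.+1])
    (solutions223 x).
  apply: uniq_perm; rewrite ?solutions223_uniq //.
    rewrite cat_uniq filter_uniq ?solutions223_uniq // andTb map_inj_uniq ?iota_uniq ?andbT.
      by apply/hasPn=> _ /mapP[s _ ->]; rewrite mem_filter.
    by move=> s s' [].
  case=> u [v s]; rewrite mem_cat mem_filter mem_solutions223 [X in 0 < X]/=.
  apply/orP/idP => [[/andP[] // | /mapP[s']] | le_x].
    by rewrite mem_iota => Hs [-> -> ->]; lia.
  have [uv0 | uv] := posnP (u + v); [right | by left].
  apply/mapP; exists s; first by rewrite mem_iota; lia.
  by congr (_, (_, _)); lia.
by rewrite size_cat size_map size_iota.
Qed.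

(** The terms added on the left make up [72 * x./2.+1], the share of the discarded solutions;
    leaving them there avoids truncated subtraction. *)
Lemma card_metacyclic_params x c : c < 6 -> x = c %[mod 6] ->
  72 * size (metacyclic_params x) + 36 * x + (if odd c then 36 else 72) =
  x ^ 3 + 12 * x ^ 2 + (if odd c then 39 else 48) * x + nth 0 [:: 72; 20; 64; 36; 56; 28] c.
Proof.
move=> lt_c6; rewrite (modn_small lt_c6) => Dc.
have Dx : x = 6 * (x %/ 6) + c by rewrite mulnC -Dc -divn_eq.
have := size_solutions223 (x %/ 6) lt_c6; cbv zeta; rewrite -Dx => <-.
rewrite -size_metacyclic_params mulnDr -addnA; congr (_ + _).
have -> : odd c = odd x by rewrite -Dc; lia.
by case: ifP => odd_x; lia.
Qed.

Import GroupScope.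

(** * Metacyclic presentations *)

Lemma conjg_expg_expn (gT : finGroupType) (a b : gT) k j :
  a ^ b = a ^+ k -> a ^ (b ^+ j) = a ^+ (k ^ j).
Proof.
move=> ab; elim: j => [|j IHj]; first by rewrite conjg1 expn0 expg1.
by rewrite expgSr conjgM IHj conjXg ab -expgM expnS.
Qed.

Lemma expgM_conj_geom (gT : finGroupType) (a b : gT) k n :
  a ^ b = a ^+ k -> (b * a) ^+ n = b ^+ n * a ^+ (\sum_(i < n) k ^ i).
Proof.
move=> ab; elim: n => [|n IHn]; first by rewrite big_ord0 mulg1.
rewrite expgSr IHn big_ord_recl expgSr -!mulgA; congr (_ * _).
rewrite (mulgA _ b a) (conjgC _ b) conjXg ab -expgM -!mulgA -expgSr; congr (_ * (_ ^+ _)).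
rewrite expn0 /bump /= -addn1 addnC; congr (1 + _).
by rewrite mulnC big_distrl; apply: eq_bigr => i _; rewrite expnSr.
Qed.

(** Only the relations are imposed, so [a] may have order less than [p ^ m]; that [G] has the full
    order [p ^ (m + n)] is a separate hypothesis. *)
Definition metacyclic_pres (p m n l r : nat) (gT : finGroupType) (G : {group gT})
    (a b : gT) :=
  [/\ G :=: <[a]> <*> <[b]>, a ^+ (p ^ m) = 1, b ^+ (p ^ n) = a ^+ (p ^ l)
    & a ^ b = a ^+ (1 + p ^ r)].

Lemma cycle_extension (gT : finGroupType) (G : {group gT}) (a b : gT) :
  G :=: <[a]> <*> <[b]> -> b \in 'N(<[a]>) ->
  [/\ <[a]> <| G, G :=: <[a]> * <[b]>, G / <[a]> = <[coset <[a]> b]>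
    & #|G| = (#[a] * #[coset <[a]> b])%N].
Proof.
move=> defG Nb.
have nAb : <[b]> \subset 'N(<[a]>) by rewrite cycle_subG.
have nAG : <[a]> <| G.
  by rewrite /normal defG joing_subl join_subG normG nAb.
have quoG : G / <[a]> = <[coset <[a]> b]>.
  by rewrite defG quotientYidl // quotient_cycle.
split=> //; first by rewrite defG norm_joinEr.
rewrite orderE -(Lagrange (normal_sub nAG)) -card_quotient ?normal_norm //.
by rewrite quoG.
Qed.

Section MetacyclicPresentation.

Variables (p m n l r : nat) (gT : finGroupType) (G : {group gT}) (a b : gT).
Hypotheses (p_pr : prime p) (presG : metacyclic_pres p m n l r G a b).

Let defG : G :=: <[a]> <*> <[b]>. Proof. by case: presG. Qed.
Let apm : a ^+ (p ^ m) = 1. Proof. by case: presG. Qed.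
Let bpn : b ^+ (p ^ n) = a ^+ (p ^ l). Proof. by case: presG. Qed.
Let ab : a ^ b = a ^+ (1 + p ^ r). Proof. by case: presG. Qed.

Let Nb : b \in 'N(<[a]>).
Proof. by rewrite inE -cycleJ cycle_subG ab mem_cycle. Qed.

Let Ga : a \in G. Proof. by rewrite defG mem_gen // inE cycle_id. Qed.
Let Gb : b \in G. Proof. by rewrite defG mem_gen // inE cycle_id orbT. Qed.

Let coset_b_dvd : #[coset <[a]> b] %| p ^ n.
Proof.
by rewrite order_dvdn -morphX //= coset_id // bpn mem_cycle.
Qed.

Lemma metacyclic_pres_card_dvd : #|G| %| p ^ (m + n).
Proof.
have [_ _ _ ->] := cycle_extension defG Nb.
by rewrite expnD dvdn_mul // order_dvdn apm.
Qed.

(** The group [<[a ^+ (p ^ r)]>] is characteristic in the normal subgroup [<[a]>], and modulo it the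
    two generators commute. *)
Lemma metacyclic_pres_der1 : G^`(1) = <[a ^+ (p ^ r)]>.
Proof.
have Rab : [~ a, b] = a ^+ (p ^ r) by rewrite /commg ab expgD expg1 mulKg.
have [nAG _ _ _] := cycle_extension defG Nb.
have nHG : G \subset 'N(<[a ^+ (p ^ r)]>).
  apply/normal_norm/(char_normal_trans _ nAG).
  by rewrite sub_cyclic_char ?cycle_cyclic ?cycleX.
apply/eqP; rewrite eqEsubset cycle_subG -Rab mem_commg // andbT Rab der1_min //.
have [nHa nHb] : a \in 'N(<[a ^+ (p ^ r)]>) /\ b \in 'N(<[a ^+ (p ^ r)]>).
  by rewrite !(subsetP nHG).
rewrite defG quotientY ?cycle_subG // !quotient_cycle // abelianY !cycle_abelian /=.
rewrite cycle_subG /= cent_cycle; apply/cent1P/commgP.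
rewrite -morphR //=; apply/eqP/coset_id.
by rewrite -invg_comm groupV Rab cycle_id.
Qed.

Hypothesis oG : #|G| = (p ^ (m + n))%N.

Lemma metacyclic_pres_order : #[a] = (p ^ m)%N /\ #[coset <[a]> b] = (p ^ n)%N.
Proof.
have p_gt0 := prime_gt0 p_pr.
have [_ _ _ oG2] := cycle_extension defG Nb.
have da : #[a] <= p ^ m by rewrite dvdn_leq ?expn_gt0 ?p_gt0 // order_dvdn apm.
have db : #[coset <[a]> b] <= p ^ n by rewrite dvdn_leq ?expn_gt0 ?p_gt0.
have pm_gt0 : 0 < p ^ m by rewrite expn_gt0 p_gt0.
have pn_gt0 : 0 < p ^ n by rewrite expn_gt0 p_gt0.
move: oG2; rewrite oG expnD.
by move: da db pm_gt0 pn_gt0; move: #[_] #[_] (p ^ m)%N (p ^ n)%N => *; nia.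
Qed.

Let oa := proj1 metacyclic_pres_order.

Lemma metacyclic_pres_dvd_expg d : (b ^+ d \in <[a]>) = (p ^ n %| d).
Proof.
rewrite -(proj2 metacyclic_pres_order) order_dvdn -morphX //=.
by apply/idP/eqP=> [/coset_id // | /coset_idr->] //; rewrite groupX.
Qed.

Lemma metacyclic_pres_order_b : l <= m -> #[b] = (p ^ (n + m - l))%N.
Proof.
move=> le_lm; apply/eqP; rewrite eqn_dvd; apply/andP; split.
  rewrite order_dvdn -addnBA // expnD expgM bpn -expgM -expnD subnKC //.
  by rewrite apm.
have : p ^ n %| #[b] by rewrite -metacyclic_pres_dvd_expg expg_order.
case/dvdnP=> d Hd; rewrite Hd -addnBA // expnD mulnC dvdn_pmul2r; last first.
  by rewrite expn_gt0 prime_gt0.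
have : b ^+ #[b] == 1 by rewrite expg_order.
rewrite {1}Hd mulnC expgM bpn -expgM -order_dvdn oa.
by rewrite -{1}(subnKC le_lm) expnD dvdn_pmul2l // expn_gt0 prime_gt0.
Qed.

Lemma metacyclic_pres_card_der1 : r <= m -> #|G^`(1)| = (p ^ (m - r))%N.
Proof.
move=> le_rm; rewrite metacyclic_pres_der1 -orderE orderXdiv oa.
  by rewrite -expnB ?prime_gt0.
by rewrite dvdn_exp2l.
Qed.

(** Already modulo [<[a]>], which contains the derived subgroup, [b] has order [p ^ n]. Conversely
    [r <= l <= n] puts the [p ^ n]-th powers of both generators into the derived subgroup. *)
Lemma metacyclic_pres_exponent_abelianization :
  r <= l -> l <= n -> exponent (G / G^`(1)) = (p ^ n)%N.
Proof.
move=> le_rl le_ln; have le_rn := leq_trans le_rl le_ln.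
have nG' := der_norm 1 G.
have [_ defGm _ _] := cycle_extension defG Nb.
have G'x d : r <= d -> a ^+ (p ^ d) \in G^`(1).
  by move=> le_rd; rewrite metacyclic_pres_der1 -(subnKC le_rd) expnD expgM mem_cycle.
apply/eqP; rewrite eqn_dvd; apply/andP; split; last first.
  have Qb : coset G^`(1) b \in G / G^`(1) by rewrite mem_quotient.
  have := expg_exponent Qb; rewrite -morphX ?(subsetP nG') //=.
  move/coset_idr; rewrite groupX ?(subsetP nG') // => /(_ isT).
  rewrite -metacyclic_pres_dvd_expg; move: (b ^+ _) => x.
  rewrite /= metacyclic_pres_der1; move: x; apply/subsetP.
  by rewrite cycleX.
apply/exponentP=> _ /morphimP[x Nx Gx ->] /=.
move: Gx; rewrite {1}defGm => /mulsgP[_ _ /cycleP[i ->] /cycleP[j ->] ->].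
have Na : a \in 'N(G^`(1)) by rewrite (subsetP nG').
have Nb' : b \in 'N(G^`(1)) by rewrite (subsetP nG').
rewrite morphM ?groupX // expgMn; last first.
  apply: (centsP (der_abelian 0 G)); apply: mem_quotient; exact: groupX.
rewrite -!morphX ?groupX //= -!expgM ![(_ * p ^ n)%N]mulnC !expgM bpn.
by rewrite (coset_id (groupX _ (G'x n le_rn))) (coset_id (groupX _ (G'x l le_rl))) mulg1.
Qed.

(** The exponent is the order of [b]. In the power of [b ^+ j * a ^+ i] with that exponent, the
    geometric sum is still divisible by [p ^ (n + m - l)], hence by [p ^ m], so the [a]-part
    vanishes too. *)
Lemma metacyclic_pres_exponent : odd p -> 0 < r -> l <= n -> l <= m ->
  exponent G = (p ^ (n + m - l))%N.
Proof.
move=> p_odd r_gt0 le_ln le_lm.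
apply/eqP; rewrite eqn_dvd -{2}metacyclic_pres_order_b // dvdn_exponent // andbT.
have [nAG _ _ _] := cycle_extension defG Nb.
apply/exponentP=> x; rewrite defG joingC norm_joinEl ?cycle_subG //.
case/mulsgP=> _ _ /cycleP[j ->] /cycleP[i ->] ->.
have aibj : (a ^+ i) ^ (b ^+ j) = (a ^+ i) ^+ ((1 + p ^ r) ^ j).
  by rewrite conjXg (conjg_expg_expn _ ab) -!expgM mulnC.
have [z Hz] : exists z, ((1 + p ^ r) ^ j = 1 + z * p)%N.
  have [t ->] := expn_succ_order2 (p ^ r) j; rewrite -(prednK r_gt0) expnS.
  by exists (j * p ^ r.-1 + p ^ r.-1 * (p * p ^ r.-1) * t)%N; ring.
have [t sumK] := sum_geom_prime_power z (n + m - l) p_pr p_odd.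
rewrite (expgM_conj_geom _ aibj) Hz sumK -!expgM ![(_ * p ^ _)%N]mulnC.
rewrite mulnCA ![(i * _)%N]mulnC !expgM.
rewrite -{1}metacyclic_pres_order_b // expg_order !expg1n.
have -> : (n + m - l)%N = (m + (n - l))%N by lia.
by rewrite expnD !expgM apm !expg1n mulg1.
Qed.

End MetacyclicPresentation.

Lemma cyclic_grank (gT : finGroupType) (G : {group gT}) : cyclic G = ('m(G) <= 1).
Proof.
apply/idP/idP=> [/cyclicP[x ->] | ].
  by rewrite (leq_trans (grank_min [set x])) ?cards1.
have [B <- <-] := grank_witness G.
rewrite leq_eqVlt ltnS leqn0 cards_eq0 => /orP[/cards1P[x ->] | /eqP->].
  exact: cycle_cyclic.
by rewrite gen0 cyclic1.
Qed.

Lemma grank_2generated (gT : finGroupType) (G : {group gT}) (a b : gT) :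
  G :=: <[a]> <*> <[b]> -> ~~ cyclic G -> 'm(G) = 2.
Proof.
move=> defG; rewrite cyclic_grank -ltnNge => lt1m; apply/eqP.
rewrite eqn_leq lt1m andbT defG joing_idl joing_idr.
by rewrite (leq_trans (grank_min _)) // cards2; case: (_ != _).
Qed.

(* The subgroup D generated by (a, c) and (b, d) satisfies the same relations, so |D| <= p^(m + n) and both projections of D are isomorphisms. *)
Lemma metacyclic_pres_isog p m n l r (gT hT : finGroupType) (G : {group gT})
    (H : {group hT}) (a b : gT) (c d : hT) : prime p ->
  metacyclic_pres p m n l r G a b -> metacyclic_pres p m n l r H c d ->
  #|G| = (p ^ (m + n))%N -> #|H| = (p ^ (m + n))%N -> G \isog H.
Proof.
move=> p_pr [defG apm bpn ab] [defH cpm dpn cd] oG oH.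
pose u := (a, c); pose v := (b, d).
pose D := <[u]> <*> <[v]>.
have expu (x : gT) (y : hT) k : (x, y) ^+ k = (x ^+ k, y ^+ k).
  by elim: k => // k IHk; rewrite !expgS IHk.
have presD : metacyclic_pres p m n l r [group of D] u v.
  split=> //; rewrite /u /v ?expu ?apm ?cpm ?bpn ?dpn //.
  by rewrite -ab -cd.
have oD := dvdn_leq _ (metacyclic_pres_card_dvd presD).
have {}oD : #|D| <= p ^ (m + n) by apply: oD; rewrite expn_gt0 prime_gt0.
have homGD : G \homg D.
  have -> : G :=: [morphism of @fst gT hT] @* D.
    by rewrite morphimY ?subsetT // !morphim_cycle ?inE.
  exact/morphim_homg/subsetT.
have homHD : H \homg D.
  have -> : H :=: [morphism of @snd gT hT] @* D.
    by rewrite morphimY ?subsetT // !morphim_cycle ?inE.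
  exact/morphim_homg/subsetT.
apply: (@isog_trans _ _ _ _ [group of D]); last rewrite isog_sym.
  by rewrite isogEcard homGD oG.
by rewrite isogEcard homHD oH.
Qed.

Lemma isog_exponent_abelianization (gT hT : finGroupType) (G : {group gT}) (H : {group hT}) :
  G \isog H -> exponent (G / G^`(1)) = exponent (H / H^`(1)).
Proof.
case/isogP=> f injf <-; rewrite -morphim_der //.
have nG' : G^`(1) <| G := der_normal 1 G.
by rewrite -(morphim_quotm f nG') (exponent_injm (injm_quotm nG' injf)).
Qed.

Lemma metacyclic_pres_powerful_rank2 p m n l r (gT : finGroupType) (G : {group gT})
    (a b : gT) : prime p -> 0 < r -> r <= l -> l <= n -> l <= m ->
  metacyclic_pres p m n l r G a b -> #|G| = (p ^ (m + n))%N ->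
  powerful_rank2 p (m + n) G.
Proof.
move=> p_pr r_gt0 le_rl le_ln le_lm presG oG; have [defG apm bpn ab] := presG.
have Ga : a \in G by rewrite defG mem_gen // inE cycle_id.
split=> //.
- by rewrite /pgroup oG pnatX pnat_id.
- rewrite /powerful -[[~: G, G]]/(G^`(1)) (metacyclic_pres_der1 presG) cycle_subG.
  apply: mem_gen; apply/imsetP; exists (a ^+ (p ^ r.-1)); rewrite ?groupX //.
  by rewrite -expgM -expnSr prednK.
(* A cyclic abelianization would have equal order and exponent, but these are [p ^ (n + r)] and
   [p ^ n]. *)
apply: grank_2generated defG _; apply/negP=> /(quotient_cyclic G^`(1)) cycGG'.
have := exponent_cyclic cycGG'.
rewrite (metacyclic_pres_exponent_abelianization p_pr presG) //.
have le_rm := leq_trans le_rl le_lm.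
rewrite card_quotient ?der_norm // -divgS ?der_sub // oG.
rewrite (metacyclic_pres_card_der1 p_pr presG) // -expnB ?prime_gt0 //; last lia.
by move/eqP; rewrite eqn_exp2l ?prime_gt1 //; lia.
Qed.

(** * Realisation of the presentations by permutations *)

Section MetacyclicConstruction.

Import GRing.Theory.
Local Open Scope ring_scope.

Variables (q M : nat) (c K : 'Z_M).
Hypotheses (q_gt0 : (0 < q)%N) (cK : c * K = c) (Kq : K ^+ q = 1).

Let T : finType := ('I_q * 'Z_M)%type.

(** The pair [(j, i)] stands for [b^j a^i], and this map is right multiplication by [a]. *)
Definition metacyclic_translation (t : T) : T := (t.1, t.2 + 1).

(* Right multiplication by b on the normal forms b^j a^i, where b^q = a^c and a^b = a^K. *)
Definition metacyclic_shift (t : T) : T :=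
  (Ordinal (ltn_pmod t.1.+1 q_gt0), K * t.2 + c * (t.1.+1 %/ q)%:R).

Lemma iter_metacyclic_translation k t :
  iter k metacyclic_translation t = (t.1, t.2 + k%:R).
Proof.
elim: k => [|k /= ->]; first by rewrite addr0; case: t.
by rewrite /metacyclic_translation -addrA -natr1.
Qed.

(** Each wrap-around of the first coordinate contributes a carry [c]. Since [c * K = c], later steps
    leave earlier carries unchanged, so the carries just add up. *)
Lemma iter_metacyclic_shift k t :
  iter k metacyclic_shift t =
  (Ordinal (ltn_pmod (t.1 + k) q_gt0), K ^+ k * t.2 + c * ((t.1 + k) %/ q)%:R).
Proof.
elim: k => [|k IHk].
  case: t => j i; rewrite /= addn0 divn_small ?ltn_ord // mulr0 addr0 mul1r.
  by congr (_, _); apply: val_inj; rewrite /= modn_small.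
rewrite iterS IHk /metacyclic_shift /=; congr (_, _).
  by apply: val_inj; rewrite /= -[in LHS]addn1 modnDml addn1 addnS.
rewrite addnS [in RHS](divn_eq (t.1 + k) q) -addnS divnMDl // natrD !mulrDr addrA.
by rewrite exprS !mulrA [K * c]mulrC cK.
Qed.

Lemma metacyclic_translation_inj : injective metacyclic_translation.
Proof.
move=> [j i] [j' i'] E; have /= -> := congr1 fst E.
by have /= /addIr -> := congr1 snd E.
Qed.

(** By [K ^+ q = 1] the [q]-th iterate is a translation by [c] in the second coordinate, which is
    injective. *)
Lemma metacyclic_shift_inj : injective metacyclic_shift.
Proof.
have iterq t : iter q metacyclic_shift t = (t.1, t.2 + c).
  case: t => j i; rewrite iter_metacyclic_shift Kq mul1r /= divnDr // divnn q_gt0.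
  rewrite divn_small // mulr1; congr (_, _).
  by apply: val_inj; rewrite /= modnDr modn_small.
apply: (@inj_compr _ _ _ (iter q.-1 metacyclic_shift)) => t u /=.
rewrite -!iterSr prednK // !iterq.
case: t u => [j i] [j' i'] E; have /= -> := congr1 fst E.
by have /= /addIr -> := congr1 snd E.
Qed.

End MetacyclicConstruction.

(** The inequalities [m <= l + r] and [m <= n + r] are what gives [c * K = c] and [K ^+ q = 1]
    modulo [p ^ m]. *)
Lemma metacyclic_pres_exists p m n l r : prime p -> odd p -> 0 < r -> 0 < m ->
  m <= l + r -> m <= n + r ->
  {gT : finGroupType & {G : {group gT} | exists a b : gT,
    metacyclic_pres p m n l r G a b /\ #|G| = (p ^ (m + n))%N}}.
Proof.
move=> p_pr p_odd r_gt0 m_gt0 le_mlr le_mnr.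
pose q := (p ^ n)%N; pose M := (p ^ m)%N.
have q_gt0 : 0 < q by rewrite expn_gt0 prime_gt0.
have M_gt1 : 1 < M by rewrite -(exp1n m) ltn_exp2r // prime_gt1.
pose K : 'Z_M := (1 + p ^ r)%:R%R; pose c : 'Z_M := (p ^ l)%:R%R.
have Z0 k : m <= k -> (p ^ k)%:R%R = 0%R :> 'Z_M.
  by move=> le_mk; rewrite -(subnKC le_mk) expnD GRing.natrM pchar_Zp // GRing.mul0r.
have cK : (c * K)%R = c.
  by rewrite -GRing.natrM mulnDr muln1 -expnD GRing.natrD (Z0 (l + r)%N) // GRing.addr0.
have Kq : (K ^+ q)%R = 1%R.
  rewrite -GRing.natrX; have [t] := expn_succ_prime_power (p ^ r.-1) n p_pr p_odd.
  rewrite mulnC -expnS prednK // => ->; rewrite mulnA -expnD GRing.natrD GRing.natrM.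
  by rewrite Z0 ?GRing.mul0r ?GRing.addr0 // addnC.
pose a := perm (@metacyclic_translation_inj q M).
pose b := perm (@metacyclic_shift_inj q M c K q_gt0 cK Kq).
have aX k t : (a ^+ k) t = (t.1, t.2 + k%:R)%R.
  rewrite permX -iter_metacyclic_translation; apply: eq_iter => {}t; exact: permE.
have bX k t : (b ^+ k) t = iter k (metacyclic_shift c K q_gt0) t.
  rewrite permX; apply: eq_iter => {}t; exact: permE.
pose G := [group of <[a]> <*> <[b]>].
have presG : metacyclic_pres p m n l r G a b.
  split=> //.
  - by apply/permP=> t; rewrite aX perm1 Z0 // GRing.addr0; case: t.
  - apply/permP=> -[j i]; rewrite aX bX iter_metacyclic_shift //= Kq GRing.mul1r.
    rewrite divnDr // divnn q_gt0 divn_small // GRing.mulr1; congr (_, _).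
    by apply: val_inj; rewrite /= modnDr modn_small.
  apply: (mulgI b); rewrite -conjgC; apply/permP=> t.
  rewrite !permM aX -[b]expg1 !bX -[a]expg1 aX /= /metacyclic_shift /=.
  congr (_, _); rewrite GRing.mulrDr GRing.mulr1 -/K.
  by rewrite GRing.addrAC.
exists {perm 'I_q * 'Z_M}; exists G; exists a, b; split=> //.
(* The relations bound the order above; the bound below holds because the orbit of [(0, 0)] is
   everything, [b ^+ j * a ^+ i] sending it to [(j, i)]. *)
have le_oG := dvdn_leq _ (metacyclic_pres_card_dvd presG).
apply/eqP; rewrite eqn_leq le_oG ?expn_gt0 ?prime_gt0 //=.
have <-: #|{: 'I_q * 'Z_M}| = (p ^ (m + n))%N.
  by rewrite card_prod !card_ord Zp_cast // expnD mulnC.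
pose t0 : 'I_q * 'Z_M := (Ordinal q_gt0, 0%R).
have Ga : a \in G by rewrite mem_gen // inE cycle_id.
have Gb : b \in G by rewrite mem_gen // inE cycle_id orbT.
apply: leq_trans (leq_imset_card (fun g : {perm _} => g t0) G).
apply/subset_leq_card/subsetP=> -[j i] _; apply/imsetP.
exists (b ^+ j * a ^+ (i : 'Z_M)); first by rewrite groupM ?groupX.
rewrite permM bX iter_metacyclic_shift // aX /= GRing.mulr0 GRing.add0r natr_Zp.
rewrite add0n divn_small // GRing.mulr0 GRing.add0r; congr (_, _).
by apply: val_inj; rewrite /= modn_small.
Qed.

(** * Powerful 2-generator groups are metacyclic *)

Lemma prime_dvd_bin2 p : prime p -> odd p -> p %| 'C(p, 2).
Proof. by move=> p_pr p_odd; rewrite prime_dvd_bin // odd_prime_gt2. Qed.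

Section PowerfulDerived.

Variables (p : nat) (p_pr : prime p) (p_odd : odd p).

Lemma powerfulE (gT : finGroupType) (G : {group gT}) :
  p.-group G -> powerful p G = (G^`(1) \subset 'Mho^1(G)).
Proof. by move=> pG; rewrite (MhoE 1 pG) expn1. Qed.

Lemma der1_Mho1_quotient (gT : finGroupType) (G H : {group gT}) :
  G \subset 'N(H) -> G^`(1) \subset 'Mho^1(G) -> (G / H)^`(1) \subset 'Mho^1(G / H).
Proof.
by move=> nHG sG'M; rewrite -quotient_der // -morphim_Mho // morphimS.
Qed.

(** The correction factor is [[~ x, y]] to the power ['C(p, 2)], which is trivial because [p]
    divides that coefficient. *)
Let class2_expgM (gT : finGroupType) (G : {group gT}) (x y : gT) :
  p.-abelem G^`(1) -> x \in G -> y \in G -> [~ x, y] \in 'C(G) ->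
  (y * x) ^+ p = y ^+ p * x ^+ p.
Proof.
move=> abG' Gx Gy /centP cxy.
rewrite expMg_Rmul; [|exact/commute_sym/cxy..].
case/dvdnP: (prime_dvd_bin2 p_pr p_odd) => k ->; rewrite mulnC expgM.
have [_ G'p] := abelemP p_pr abG'.
by rewrite (G'p _ (mem_commg Gx Gy)) expg1n mulg1.
Qed.

(** For [x], [y] in [G], [(x ^+ p) ^ y] equals [(x * [~ x, y]) ^+ p = x ^+ p * [~ x, y] ^+ p = x ^+
    p]. So [p]-th powers are central, and the derived subgroup lies in the group they generate. *)
Let der1_central_class3 (gT : finGroupType) (G : {group gT}) :
  G^`(1) \subset 'Mho^1(G) -> p.-group G -> p.-abelem G^`(1) ->
  [~: [~: G^`(1), G], G] = 1 -> [~: G^`(1), G] = 1.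
Proof.
move=> sG'M pG abG' /commG1P cL; apply/commG1P; apply: subset_trans sG'M _.
rewrite (MhoE 1 pG) gen_subG; apply/subsetP=> _ /imsetP[x Gx ->].
apply/centP=> y Gy; apply/commgP/conjg_fixP; rewrite expn1 conjXg.
have G'c : [~ x, y] \in G^`(1) by apply: mem_commg.
have Gc : [~ x, y] \in G by rewrite groupR.
have [_ G'p] := abelemP p_pr abG'.
rewrite -[x ^ y](mulKVg x) -commgEl (class2_expgM abG' Gc Gx) ?(G'p _ G'c) ?mulg1 //.
by apply: (subsetP cL); apply: mem_commg.
Qed.

(** Modulo [[~: H, G]] the class 3 case applies, so [H] is contained in [[~: H, G]]; nilpotency then
    forces [H = 1]. *)
Let der1_central_abelem (gT : finGroupType) (G : {group gT}) :
  G^`(1) \subset 'Mho^1(G) -> p.-group G -> p.-abelem G^`(1) ->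
  [~: G^`(1), G] = 1.
Proof.
move=> sG'M pG abG'; set H := [~: G^`(1), G].
have sHG : H \subset G by rewrite commg_subr (subset_trans (der_sub 1 G)) ?normG.
have nNG : G \subset 'N([~: H, G]) by rewrite commg_normr.
have sHN : H \subset [~: H, G].
  rewrite -quotient_sub1 ?(subset_trans sHG) // quotientR ?gFsub_trans //.
  rewrite quotient_der // (der1_central_class3 _ _) ?quotient_pgroup //.
  - exact: der1_Mho1_quotient.
  - by rewrite -quotient_der // quotient_abelem.
  rewrite -quotient_der // -[X in [~: X, _]]quotientR ?gFsub_trans //.
  by rewrite -quotientR ?(subset_trans sHG) // trivg_quotient.
apply/eqP; have /forall_inP nilG := pgroup_nil pG.
by apply: (nilG [group of H]); rewrite subsetI sHG.
Qed.

Let Mho1_class2 (gT : finGroupType) (G : {group gT}) :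
  p.-group G -> p.-abelem G^`(1) -> G^`(1) \subset 'C(G) ->
  'Mho^1(G) = [set x ^+ p | x in G].
Proof.
move=> pG abG' cG'; rewrite (MhoE 1 pG) expn1 gen_set_id //.
apply/group_setP; split; first by apply/imsetP; exists 1; rewrite ?expg1n.
move=> _ _ /imsetP[x Gx ->] /imsetP[y Gy ->]; apply/imsetP.
exists (x * y); first by rewrite groupM.
by rewrite (class2_expgM abG') // (subsetP cG') // mem_commg.
Qed.

Let der1_sub_cycle_abelem (gT : finGroupType) (G : {group gT}) (x y : gT) :
  G^`(1) \subset 'Mho^1(G) -> p.-group G -> G :!=: 1 ->
  p.-abelem G^`(1) -> G :=: <[x]> <*> <[y]> ->
  exists2 d, d \in G & d \notin 'Phi(G) /\ G^`(1) \subset <[d]>.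
Proof.
move=> sG'M pG ntG abG' defG.
have /commG1P cG' := der1_central_abelem sG'M pG abG'.
have [G'1 | ntG'] := eqVneq G^`(1) 1.
  have [_ [d Gd nPd]] := properP (Phi_proper ntG).
  by exists d; rewrite // G'1 sub1G.
have Gx : x \in G by rewrite defG mem_gen // inE cycle_id.
have Gy : y \in G by rewrite defG mem_gen // inE cycle_id orbT.
have G'z : [~ x, y] \in G^`(1) by apply: mem_commg.
have defG' : G^`(1) = <[ [~ x, y] ]>.
  rewrite {1}defG der1_joing_cycles // -defG; exact: (subsetP cG').
(* Maximal order excludes [d = e ^+ p]: then [e] would also satisfy [P] and have [p] times the order
   of [d]. *)
pose P d := (d \in G) && (G^`(1) \subset <[d]>).
have Pz : P [~ x, y] by rewrite /P groupR // defG' subxx.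
have [d /andP[Gd sG'd] max_d] := arg_maxnP (fun d => #[d]) Pz.
exists d => //; split=> //; apply/negP.
rewrite (Phi_joing pG) (joing_idPr sG'M) /= (Mho1_class2 pG abG' cG').
case/imsetP=> e Ge def_d.
have ntd : d != 1.
  by apply: contraNneq ntG' => d1; rewrite -subG1 -cycle1 -d1.
have nte : e != 1 by apply: contraNneq ntd => e1; rewrite def_d e1 expg1n.
have ntE : <[e]> != 1 by rewrite cycle_eq1.
have [_ p_e _] := pgroup_pdiv (mem_p_elt pG Ge) ntE.
have := max_d e; rewrite /P Ge (subset_trans sG'd) def_d ?mem_cycle ?cycleX //.
move=> /(_ isT) /=; rewrite orderXdiv // leq_divRL ?prime_gt0 //; apply/negP.
by rewrite -ltnNge ltn_Pmulr ?prime_gt1 ?order_gt0.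
Qed.

(** The abelem case applies to [G / K] with [K] the Frattini subgroup of the derived subgroup.
    Lifting back, [G^](1)[is generated by]K[and]<[d]> :&: G^[(1)], and [K] consists of
    non-generators. *)
Lemma powerful_der1_sub_cycle (gT : finGroupType) (G : {group gT}) (x y : gT) :
  p.-group G -> powerful p G -> G :!=: 1 -> G :=: <[x]> <*> <[y]> ->
  exists2 d, d \in G & d \notin 'Phi(G) /\ G^`(1) \subset <[d]>.
Proof.
move=> pG; rewrite powerfulE // => sG'M ntG defG.
set K := 'Phi(G^`(1))%G.
have pG' : p.-group G^`(1) by apply: pgroupS pG; apply: der_sub.
have nKG : G \subset 'N(K) by apply: char_norm_trans (Phi_char _) (der_norm 1 G).
have Gx : x \in G by rewrite defG mem_gen // inE cycle_id.
have Gy : y \in G by rewrite defG mem_gen // inE cycle_id orbT.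
have defQ : G / K = <[coset K x]> <*> <[coset K y]>.
  by rewrite {1}defG quotientY ?cycle_subG ?(subsetP nKG) // !quotient_cycle ?(subsetP nKG).
have sKG' : K \subset G^`(1) := Phi_sub _.
have sKP : K \subset 'Phi(G) by apply: subset_trans sKG' _; rewrite (Phi_joing pG) joing_subl.
have ntQ : G / K != 1.
  rewrite -subG1 quotient_sub1 //; apply: contraL (Phi_proper ntG) => sGK.
  by rewrite properE Phi_sub /= (subset_trans sGK sKP).
have abQ' : p.-abelem (G / K)^`(1) by rewrite -quotient_der // Phi_quotient_abelem.
have [_ /morphimP[d Nd Gd ->] [nPd sQ'd]] :=
  der1_sub_cycle_abelem (der1_Mho1_quotient nKG sG'M) (quotient_pgroup K pG) ntQ abQ' defQ.
exists d => //; split.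
  by apply: contra nPd => Pd; rewrite -(quotient_Phi pG nKG) mem_quotient.
have sG'Kd : G^`(1) \subset K * <[d]>.
  rewrite -quotientSK ?(subset_trans (der_sub 1 G)) //.
  by rewrite quotient_der // quotient_cycle.
have : K <*> (<[d]> :&: G^`(1)) = G^`(1).
  rewrite norm_joinEr; last by rewrite subIset // (subset_trans (der_sub 1 G) nKG) orbT.
  by rewrite group_modl //; apply/setIidPr.
by move/Phi_nongen; rewrite genGid => <-; apply: subsetIl.
Qed.

End PowerfulDerived.

(** Since ['Phi(G)] has index at most [p ^ 2] and misses [d], the subgroup [M] has index at most
    [p]. Any [e] generating [G] modulo [M] completes [d] to a generating pair modulo ['Phi(G)],
    hence of [G]. *)
Lemma pgroup_complete_generators p (gT : finGroupType) (G : {group gT}) (d : gT) :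
  prime p -> p.-group G -> 'm(G) <= 2 -> d \in G -> d \notin 'Phi(G) ->
  exists2 e, e \in G & G :=: <[d]> <*> <[e]>.
Proof.
move=> p_pr pG mG Gd nPd.
pose M := [group of <[d]> <*> 'Phi(G)].
have sMG : M \subset G by rewrite join_subG cycle_subG Gd Phi_sub.
have sPM : 'Phi(G) \subset M by apply: joing_subr.
have nMG : M <| G.
  apply: sub_der1_normal => //; apply: subset_trans sPM.
  by rewrite (Phi_joing pG) joing_subl.
have pGM : p.-nat #|G : M| := pnat_dvd (dvdn_indexg G M) pG.
have pMP : p.-nat #|M : 'Phi(G)|.
  by apply: pnat_dvd (dvdn_indexg _ _) _; apply: pgroupS pG.
have abE : p.-abelem (G / 'Phi(G)) := Phi_quotient_abelem pG.
have le2 : logn p #|G : 'Phi(G)| <= 2.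
  rewrite -card_quotient ?gFnorm // -(rank_abelem abE) -grank_abelian ?(abelem_abelian abE) //.
  by apply: leq_trans mG; apply: quotient_grank; rewrite gFnorm.
have cycGM : cyclic (G / M).
  have [i Di] := p_natP pGM; have [j Dj] := p_natP pMP.
  have j_gt0 : 0 < j.
    rewrite lt0n; apply: contraNneq nPd => j0; rewrite j0 expn0 in Dj.
    have sMP : M \subset 'Phi(G) by rewrite -indexg_eq1 Dj.
    by apply: (subsetP sMP); rewrite mem_gen // inE cycle_id.
  have le_i1 : i <= 1.
    move: le2; rewrite -(Lagrange_index sMG sPM) Di Dj -expnD pfactorK //.
    by move: j_gt0; clear; lia.
  have oGM : #|G / M| = (p ^ i)%N by rewrite card_quotient ?normal_norm.
  case: i le_i1 {Di} oGM => [|[|//]] _ oGM; last by apply: prime_cyclic; rewrite oGM.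
  by rewrite (card1_trivg oGM) cyclic1.
have [Q defQ] := cyclicP cycGM.
have : Q \in G / M by rewrite defQ cycle_id.
case/morphimP=> e Ne Ge DQ; exists e => //.
have sG : G \subset 'Phi(G) <*> (<[d]> <*> <[e]>).
  have sGM : G \subset M * <[e]>.
    by rewrite -quotientSK ?normal_norm // quotient_cycle // -DQ -defQ.
  apply: subset_trans sGM _; rewrite mul_subG //.
    by rewrite /M /= joingC genS // setUS // joing_subl.
  by apply: subset_trans (joing_subr _ _); apply: joing_subr.
have := @Phi_nongen _ G (<[d]> <*> <[e]>); rewrite genGid => -> //.
by apply/eqP; rewrite eqEsubset sG andbT !join_subG Phi_sub !cycle_subG Gd Ge.
Qed.

(** * Normal form *)

Lemma coprime_succ_mul p n t : coprime (p ^ n) (1 + t * p).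
Proof. by apply: coprimeXl; rewrite /coprime addnC gcdnMDl gcdn1. Qed.

Lemma one_unit_prime_power p r n : prime p -> odd p -> 0 < r ->
  exists t, ((1 + p ^ r) ^ (p ^ n) = 1 + p ^ (r + n) * (1 + t * p))%N.
Proof.
move=> p_pr p_odd r_gt0; have [t] := expn_succ_prime_power (p ^ r.-1) n p_pr p_odd.
by rewrite -expnSr prednK // => ->; exists t; rewrite mulnA -expnD.
Qed.

(** The element [b ^+ (p ^ n) = a ^+ (p ^ l)] commutes with [b], giving the first bound, and with
    [a], giving the second. *)
Lemma metacyclic_pres_bounds p m n l r (gT : finGroupType) (G : {group gT}) (a b : gT) :
  prime p -> odd p -> 0 < r ->
  metacyclic_pres p m n l r G a b -> #|G| = (p ^ (m + n))%N ->
  m <= l + r /\ m <= n + r.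
Proof.
move=> p_pr p_odd r_gt0 presG oG; have [defG apm bpn ab] := presG.
have [oa _] := metacyclic_pres_order p_pr presG oG.
have p_gt1 := prime_gt1 p_pr.
split.
  have : a ^+ (p ^ l) ^ b = a ^+ (p ^ l).
    by apply/conjg_fixP/commgP; rewrite -bpn; apply/commute_sym/commuteX.
  rewrite conjXg ab expgD expg1 expgMn; last exact: commuteX.
  move/(canRL (mulKg _)); rewrite mulVg -expgM -expnD => /eqP.
  by rewrite -order_dvdn oa dvdn_Pexp2l // addnC.
have : a ^ (b ^+ (p ^ n)) = a by rewrite bpn; apply/conjg_fixP/commgP/commuteX.
have [t Ht] := one_unit_prime_power n p_pr p_odd r_gt0.
rewrite (conjg_expg_expn _ ab) Ht expgD expg1 => /(canRL (mulKg _)).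
rewrite mulVg => /eqP; rewrite -order_dvdn oa Gauss_dvdl ?coprime_succ_mul //.
by rewrite dvdn_Pexp2l // addnC.
Qed.

Lemma metacyclic_pres_reduce p m n l r (gT : finGroupType) (G : {group gT}) (a b : gT) :
  prime p -> odd p -> 0 < r -> n < l ->
  metacyclic_pres p m n l r G a b -> exists b', metacyclic_pres p m n n r G a b'.
Proof.
move=> p_pr p_odd r_gt0 lt_nl [defG apm bpn ab].
have [t sumK] := sum_geom_prime_power (p ^ r.-1) n p_pr p_odd.
rewrite -expnSr prednK // in sumK.
have pm_gt0 : 0 < p ^ m by rewrite expn_gt0 prime_gt0.
have [i _] := Bezoutl (1 + t * p) pm_gt0.
rewrite (eqP (coprime_succ_mul p m t)) => /dvdnP[h Hh].
have plen : 0 < p ^ (l - n) by rewrite expn_gt0 prime_gt0.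
(* Modulo [p ^ m], [i] is minus the inverse of [1 + t * p], so [(b * a ^+ g) ^+ (p ^ n)] has
   [a]-exponent [p ^ l - p ^ n * f = p ^ n]. *)
set f := (p ^ (l - n)).-1; set g := (i * f)%N.
have abg : a ^ (b * a ^+ g) = a ^+ (1 + p ^ r).
  by rewrite conjgM ab conjXg; congr (_ ^+ _); apply/conjg_fixP/commgP/commuteX.
have agb : (a ^+ g) ^ b = (a ^+ g) ^+ (1 + p ^ r).
  by rewrite conjXg ab -!expgM mulnC.
exists (b * a ^+ g); split=> //.
  apply/eqP; rewrite defG eqEsubset !join_subG !joing_subl !cycle_subG /=; apply/andP; split.
    rewrite -{1}(mulgK (a ^+ g) b) groupM //; first by rewrite mem_gen // inE cycle_id orbT.
    by rewrite groupV mem_gen // inE mem_cycle.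
  by rewrite groupM // mem_gen // inE ?mem_cycle ?cycle_id // orbT.
rewrite (expgM_conj_geom _ agb) sumK bpn -!expgM -expgD.
have -> : (p ^ l + g * (p ^ n * (1 + t * p)) = p ^ n + p ^ m * (p ^ n * f * h))%N.
  rewrite -(subnKC (ltnW lt_nl)) expnD -{1}(prednK plen) -/f /g.
  transitivity (p ^ n * (1 + f * (1 + i * (1 + t * p))))%N; first by ring.
  by rewrite Hh; ring.
by rewrite expgD (expgM a (p ^ m)) apm expg1n mulg1.
Qed.

Lemma metacyclic_pres_of_der1_sub_cycle p (gT : finGroupType) (G : {group gT}) (d : gT) :
  prime p -> odd p -> p.-group G -> 'm(G) = 2 -> d \in G -> d \notin 'Phi(G) ->
  G^`(1) \subset <[d]> ->
  exists a b m n l r, [/\ <[a]> = <[d]>, metacyclic_pres p m n l r G a b,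
    #|G| = (p ^ (m + n))%N & [/\ 0 < r, r <= m, l <= n & l <= m]].
Proof.
move=> p_pr p_odd pG mG Gd nPd sG'd.
have [|e Ge defG] := pgroup_complete_generators p_pr pG _ Gd nPd; first by rewrite mG.
have nAG : <[d]> <| G by apply: sub_der1_normal => //; rewrite cycle_subG.
have [m od] : {m | #[d] = (p ^ m)%N} by apply: p_natP; apply: mem_p_elt Gd.
have ntd : d != 1 by apply: contraNneq nPd => ->.
have m_gt0 : 0 < m.
  by rewrite lt0n; apply: contra ntd => /eqP m0; rewrite -order_eq1 od m0.
have dpm : d ^+ (p ^ m) = 1 by rewrite -od expg_order.
have [k Rde] : exists k, [~ d, e] = d ^+ k.
  by have /cycleP[k ?] := subsetP sG'd _ (mem_commg Gd Ge); exists k.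
(* Otherwise the commutator [d ^+ k] would generate [<[d]>], putting [d] in ['Phi(G)]. *)
have p_k : p %| k.
  apply: contraR nPd; rewrite -prime_coprime // => co_pk.
  have : generator <[d]> (d ^+ k) by rewrite generator_coprime od coprimeXl.
  move/eqP=> gend; have : d \in <[d ^+ k]> by rewrite -gend cycle_id.
  apply: subsetP; rewrite cycle_subG -Rde /= (Phi_joing pG).
  by rewrite mem_gen // inE mem_commg.
(* Replacing e by a power turns the conjugation exponent into exactly 1 + p^r. *)
have [r [c [r_gt0 le_rm co_pc dec]]] : exists r c, [/\ 0 < r, r <= m, coprime p c &
    d ^ (e ^+ c) = d ^+ (1 + p ^ r)].
  have de : d ^ e = d ^+ (1 + k) by rewrite expgD expg1 -Rde commgEl mulKVg.
  (* If [d] and [e] commute, [r = m] encodes the trivial action. *)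
  have [dk | ntdk] := eqVneq (d ^+ k) 1.
    exists m, 1%N; rewrite coprimen1 expg1; split=> //.
    by rewrite de !expgD dk dpm.
  have k_gt0 : 0 < k by rewrite lt0n; apply: contraNneq ntdk => ->.
  have [w co_pw Dk] := pfactor_coprime p_pr k_gt0; set r := logn p k in Dk.
  have r_gt0 : 0 < r by rewrite logn_gt0 mem_primes p_pr k_gt0.
  have lt_rm : r < m.
    rewrite ltnNge; apply: contra ntdk => le_mr; rewrite -order_dvdn od Dk.
    by rewrite dvdn_mull // dvdn_exp2l.
  have bd_r : 0 < r < m by rewrite r_gt0.
  have [c [z [co_pc kc]]] := one_units_log_coprime p_pr p_odd co_pw bd_r.
  exists r, c; split=> //; first exact: ltnW.
  rewrite (conjg_expg_expn _ de) Dk mulnC kc expgD (expgM d (p ^ m)) dpm expg1n.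
  by rewrite mulg1.
set b0 := e ^+ c in dec.
have pe : p.-elt e := mem_p_elt pG Ge.
have defb0 : <[b0]> = <[e]>.
  have [j oe] : {j | #[e] = (p ^ j)%N} by apply: p_natP.
  by apply/esym/eqP; rewrite -[_ == _]/(generator <[e]> b0) generator_coprime oe coprimeXl.
have Nb0 : b0 \in 'N(<[d]>).
  by rewrite groupX // (subsetP (normal_norm nAG)).
have defG0 : G :=: <[d]> <*> <[b0]> by rewrite defb0.
have [_ _ _ oG] := cycle_extension defG0 Nb0.
have [n on] : {n | #[coset <[d]> b0] = (p ^ n)%N}.
  by apply: p_natP; apply: morph_p_elt => //; apply: p_eltX.
have [j Hj] : exists j, b0 ^+ (p ^ n) = d ^+ j.
  apply/cycleP; apply: coset_idr; first by rewrite groupX.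
  by rewrite morphX // -on expg_order.
(* The part of [j] prime to [p] is absorbed into the generator [a]. This preserves the conjugation
   relation, as [b0] acts on all of [<[d]>] by the same power map. *)
have [a [l [da le_lm apl]]] : exists a l,
    [/\ <[a]> = <[d]>, l <= m & b0 ^+ (p ^ n) = a ^+ (p ^ l)].
  have [dj | ntdj] := eqVneq (d ^+ j) 1.
    by exists d, m; split; rewrite // Hj dj dpm.
  have j_gt0 : 0 < j by rewrite lt0n; apply: contraNneq ntdj => ->.
  have [w co_pw Dj] := pfactor_coprime p_pr j_gt0.
  exists (d ^+ w), (logn p j); split.
  - by apply/esym/eqP; rewrite -[_ == _]/(generator <[d]> _) generator_coprime od coprimeXl.
  - rewrite leqNgt; apply: contra ntdj => lt_mj; rewrite -order_dvdn od Dj.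
    by rewrite dvdn_mull // dvdn_exp2l // ltnW.
  by rewrite Hj {1}Dj expgM.
have ab0 : a ^ b0 = a ^+ (1 + p ^ r).
  have /cycleP[i ->] : a \in <[d]> by rewrite -da cycle_id.
  by rewrite conjXg dec -!expgM mulnC.
have presG : metacyclic_pres p m n l r G a b0.
  by split; rewrite // ?da // -od orderE -da -orderE expg_order.
rewrite od on -expnD in oG.
have [le_ln | lt_nl] := leqP l n.
  by exists a, b0, m, n, l, r.
have [b' presG'] := metacyclic_pres_reduce p_pr p_odd r_gt0 lt_nl presG.
by exists a, b', m, n, n, r; split=> //; split=> //; apply: leq_trans (ltnW lt_nl) le_lm.
Qed.

(* If l < r then G has class 2, so that (g a)^(p^l) = g^(p^l) a^(p^l); taking for g the power of b with g^(p^l) = a^(p^r - p^l) makes (g a)^(p^l) a generator of G'. *)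
Lemma metacyclic_pres_shorten p m n l r (gT : finGroupType) (G : {group gT}) (a b : gT) :
  prime p -> odd p -> metacyclic_pres p m n l r G a b -> m <= l + r ->
  l < r -> r <= m -> l <= n -> ~~ cyclic G ->
  exists2 d, d \in G & [/\ d \notin 'Phi(G), G^`(1) \subset <[d]> & #[d] < p ^ m].
Proof.
move=> p_pr p_odd presG le_mlr lt_lr le_rm le_ln ncG.
have [defG apm bpn ab] := presG.
have p_gt1 := prime_gt1 p_pr.
have Ga : a \in G by rewrite defG mem_gen // inE cycle_id.
have Gb : b \in G by rewrite defG mem_gen // inE cycle_id orbT.
have defG' := metacyclic_pres_der1 presG.
(* From [m <= l + r] and [l < r] one gets [m <= r + r], so conjugation by [b] fixes
   [a ^+ (p ^ r)]. *)
have cG' : G^`(1) \subset 'C(G).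
  rewrite defG' cycle_subG /= defG centY !cent_cycle inE; apply/andP; split.
    by apply/cent1P/commute_sym/commuteX.
  apply/cent1P/commgP/conjg_fixP.
  rewrite conjXg ab -!expgM mulnDl mul1n expgD.
  have -> : (p ^ r * p ^ r = p ^ m * p ^ (r + r - m))%N.
    by rewrite -!expnD; congr (_ ^ _)%N; lia.
  by rewrite (expgM a (p ^ m)) apm expg1n mulg1.
have G'p y : y \in G^`(1) -> y ^+ (p ^ l) = 1.
  rewrite defG' => /cycleP[i ->]; rewrite -!expgM mulnCA -expnD.
  have -> : (p ^ (r + l) = p ^ m * p ^ (r + l - m))%N.
    by rewrite -expnD; congr (_ ^ _)%N; lia.
  by rewrite mulnCA expgM apm expg1n.
(* With this [f], [g ^+ (p ^ l)] is [b ^+ (p ^ n)] raised to [p ^ (r - l) - 1], that is,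
   [a ^+ (p ^ r - p ^ l)]. *)
pose f := (p ^ (n - l) * (p ^ (r - l)).-1)%N.
pose g := b ^+ f; pose d := g * a.
have Gg : g \in G by apply: groupX.
have dpl : d ^+ (p ^ l) = a ^+ (p ^ r).
  have /centP cag : [~ a, g] \in 'C(G) by apply: (subsetP cG'); apply: mem_commg.
  rewrite expMg_Rmul; [|exact/commute_sym/cag..].
  have /dvdnP[h ->] : p ^ l %| 'C(p ^ l, 2).
    have [w Dw] : exists w, (p ^ l)%N = (1 + 2 * w)%N.
      by exists (p ^ l)./2; rewrite mul2n -[LHS]odd_double_half oddX p_odd orbT.
    by rewrite bin2 {3}Dw /= mulnCA mul2n doubleK dvdn_mulr.
  rewrite mulnC expgM (G'p _ (mem_commg Ga Gg)) expg1n mulg1 /g /f.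
  rewrite -expgM mulnAC -expnD subnK // expgM bpn -expgM -expgD.
  congr (_ ^+ _); rewrite -{2}(muln1 (p ^ l)%N) -mulnDr addn1 prednK ?expn_gt0 ?prime_gt0 //.
  by rewrite -expnD subnKC // ltnW.
exists d; first exact: groupM.
split.
(* If [d = g * a] lay in ['Phi(G)], then [b] alone would generate [G], [g] being a power of [b]. *)
- apply: contra ncG => Pd.
  have : 'Phi(G) <*> <[b]> = G.
    apply/eqP; rewrite eqEsubset join_subG Phi_sub cycle_subG Gb /=.
    rewrite {1}defG join_subG joing_subr andbT cycle_subG -(mulKg g a) groupM //.
      by rewrite groupV mem_gen // inE mem_cycle orbT.
    by rewrite mem_gen // inE Pd.
  by move/Phi_nongen; rewrite genGid => <-; apply: cycle_cyclic.
- by rewrite defG' -dpl cycleX.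
have : #[d] %| p ^ (l + (m - r)).
  by rewrite order_dvdn expnD expgM dpl -expgM -expnD subnKC // apm.
move/dvdn_leq; rewrite expn_gt0 prime_gt0 // => /(_ isT) /leq_ltn_trans; apply.
by rewrite ltn_exp2l //; lia.
Qed.

Lemma powerful_rank2_metacyclic_pres p x (gT : finGroupType) (G : {group gT}) :
  prime p -> odd p -> powerful_rank2 p x G ->
  exists m n l r a b, [/\ metacyclic_pres p m n l r G a b, m + n = x,
    0 < r <= l & [/\ l <= n, l <= m & m <= l + r]].
Proof.
move=> p_pr p_odd [pG oG powG mG].
have ncG : ~~ cyclic G by rewrite cyclic_grank mG.
have ntG : G :!=: 1 by apply: contraNneq ncG => ->; apply: cyclic1.
have [y [z defG]] : exists y z, G :=: <[y]> <*> <[z]>.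
  have [B defB /eqP] := grank_witness G.
  rewrite mG => /cards2P[y [z [_ DB]]]; exists y, z.
  by rewrite joing_idl joing_idr -defB DB.
have [d0 Gd0 [nPd0 sG'd0]] := powerful_der1_sub_cycle p_pr p_odd pG powG ntG defG.
pose P d := [&& d \in G, d \notin 'Phi(G) & G^`(1) \subset <[d]>].
have Pd0 : P d0 by rewrite /P Gd0 nPd0.
(* Minimality of the order of [d] is what yields [r <= l]: for [l < r], [metacyclic_pres_shorten]
   produces a shorter element satisfying [P]. *)
have [d /and3P[Gd nPd sG'd] min_d] := arg_minnP (fun d => #[d]) Pd0.
have [a [b [m [n [l [r [da presG oGmn [r_gt0 le_rm le_ln le_lm]]]]]]]] :=
  metacyclic_pres_of_der1_sub_cycle p_pr p_odd pG mG Gd nPd sG'd.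
have [le_mlr _] := metacyclic_pres_bounds p_pr p_odd r_gt0 presG oGmn.
exists m, n, l, r, a, b; split=> //.
  by apply/eqP; rewrite -(eqn_exp2l _ _ (prime_gt1 p_pr)) -oGmn oG.
rewrite r_gt0 leqNgt; apply/negP=> lt_lr.
have [d1 Gd1 [nPd1 sG'd1]] :=
  metacyclic_pres_shorten p_pr p_odd presG le_mlr lt_lr le_rm le_ln ncG.
have [oa _] := metacyclic_pres_order p_pr presG oGmn.
by rewrite -oa (orderE a) da -orderE ltnNge min_d // /P Gd1 nPd1.
Qed.

(** * Classification *)

Lemma metacyclic_pres_isog_inj p m n l r m' n' l' r' (gT hT : finGroupType)
    (G : {group gT}) (H : {group hT}) (a b : gT) (c d : hT) :
  prime p -> odd p ->
  metacyclic_pres p m n l r G a b -> metacyclic_pres p m' n' l' r' H c d ->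
  #|G| = (p ^ (m + n))%N -> #|H| = (p ^ (m' + n'))%N ->
  0 < r <= l -> l <= n -> l <= m -> 0 < r' <= l' -> l' <= n' -> l' <= m' ->
  G \isog H -> [/\ m = m', n = n', l = l' & r = r'].
Proof.
move=> p_pr p_odd presG presH oG oH /andP[r_gt0 le_rl] le_ln le_lm.
move=> /andP[r'_gt0 le_rl'] le_ln' le_lm' isoGH.
have inj_p i j : (p ^ i)%N = (p ^ j)%N -> i = j by apply: expnI; apply: prime_gt1.
have E1 : (m + n = m' + n')%N by apply: inj_p; rewrite -oG -oH (card_isog isoGH).
have E2 : n = n'.
  apply: inj_p.
  rewrite -(metacyclic_pres_exponent_abelianization p_pr presG oG) //.
  rewrite -(metacyclic_pres_exponent_abelianization p_pr presH oH) //.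
  exact: isog_exponent_abelianization.
have E3 : (n + m - l = n' + m' - l')%N.
  apply: inj_p; rewrite -(metacyclic_pres_exponent p_pr presG oG) //.
  by rewrite -(metacyclic_pres_exponent p_pr presH oH) // (exponent_isog isoGH).
have le_rm := leq_trans le_rl le_lm; have le_rm' := leq_trans le_rl' le_lm'.
have E4 : (m - r = m' - r')%N.
  apply: inj_p; rewrite -(metacyclic_pres_card_der1 p_pr presG oG) //.
  rewrite -(metacyclic_pres_card_der1 p_pr presH oH) //.
  by case/isogP: isoGH => f injf <-; rewrite -morphim_der // card_injm ?der_sub.
by split; lia.
Qed.

Lemma powerful_rank2_isog_classes p x : prime p -> odd p ->
  num_isog_classes (powerful_rank2 p x) (size (metacyclic_params x)).
Proof.
move=> p_pr p_odd; pose N := size (metacyclic_params x).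
pose t (i : 'I_N) := nth (0, (0, 0))%N (metacyclic_params x) i.
pose u i := (t i).1; pose v i := (t i).2.1; pose s i := (t i).2.2.
(* These formulas invert [u = m - l], [v = r - u], [s = l - r]; the slack [t = n - l] is
   [x - m - l]. *)
pose m i := (2 * u i + v i + s i)%N; pose n i := (x - m i)%N.
pose l i := (u i + v i + s i)%N; pose r i := (u i + v i)%N.
have bounds i : 0 < r i /\ m i + l i <= x.
  have : t i \in metacyclic_params x by apply: mem_nth.
  rewrite mem_filter /m /l /r /u /v /s; case: (t i) => u' [v' s'] /=.
  by rewrite mem_solutions223 => /andP[]; lia.
have existsG (i : 'I_N) : {gT : finGroupType & {G : {group gT} | exists a b : gT,
    metacyclic_pres p (m i) (n i) (l i) (r i) G a b /\ #|G| = (p ^ (m i + n i))%N}}.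
  have [r_gt0 le_x] := bounds i.
  by apply: metacyclic_pres_exists => //; move: r_gt0 le_x; rewrite /n /m /l /r; lia.
exists (fun i => tag (existsG i)), (fun i => sval (tagged (existsG i))); split.
- move=> i; have [a [b [presG oG]]] := svalP (tagged (existsG i)).
  have [r_gt0 le_x] := bounds i.
  have <- : (m i + n i)%N = x by rewrite /n; lia.
  apply: metacyclic_pres_powerful_rank2 presG oG => //;
    move: r_gt0 le_x; rewrite /n /m /l /r; lia.
- move=> i j isoG; have [a [b [presG oG]]] := svalP (tagged (existsG i)).
  have [c [d [presH oH]]] := svalP (tagged (existsG j)).
  have [ri_gt0 le_xi] := bounds i; have [rj_gt0 le_xj] := bounds j.
  have [||||||Em En El Er] :=
      metacyclic_pres_isog_inj p_pr p_odd presG presH oG oH _ _ _ _ _ _ isoG.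
  1-6: by move: ri_gt0 le_xi rj_gt0 le_xj; rewrite /n /m /l /r; lia.
  apply/val_inj/eqP; rewrite -(nth_uniq (0, (0, 0))%N (ltn_ord i) (ltn_ord j)); last first.
    by rewrite filter_uniq ?solutions223_uniq.
  move: Em El Er; rewrite -/(t i) -/(t j) /m /l /r /u /v /s.
  case: (t i) (t j) => [u1 [v1 s1]] [u2 [v2 s2]] /= Em El Er.
  by rewrite !xpair_eqE; lia.
move=> hT H rank2H; have [_ oH _ _] := rank2H.
have [m' [n' [l' [r' [a [b [presH Dx /andP[r_gt0 le_rl] [le_ln le_lm le_mlr]]]]]]]] :=
  powerful_rank2_metacyclic_pres p_pr p_odd rank2H.
(* No subtraction truncates here, since [m' - l' <= r' <= l' <= m']. *)
pose t' := (m' - l', (r' - (m' - l'), l' - r'))%N.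
have t'in : t' \in metacyclic_params x.
  by rewrite mem_filter mem_solutions223 /=; lia.
have lt_t' : index t' (metacyclic_params x) < N by rewrite index_mem.
exists (Ordinal lt_t'); set i := Ordinal lt_t'.
have ti : t i = t' by rewrite /t nth_index.
have [c [d [presG oG]]] := svalP (tagged (existsG i)).
have Em : m i = m' by rewrite /m /u /v /s ti /=; lia.
have En : n i = n' by rewrite /n Em; lia.
have El : l i = l' by rewrite /l /u /v /s ti /=; lia.
have Er : r i = r' by rewrite /r /u /v ti /=; lia.
rewrite -Em -En -El -Er in presH.
by apply: metacyclic_pres_isog p_pr presH presG _ oG; rewrite Em En Dx.
Qed.

(** * The closed formulas over the rationals *)

Import GRing.Theory Num.Theory.
Local Open Scope ring_scope.

Theorem mainTheorem3 (p x : nat) (p_pr : prime p) (p_odd : odd p)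
    (x_ge3 : (3 <= x)%N) :
  exists n : nat,
    num_isog_classes (powerful_rank2 p x) n /\
    let X : rat := x%:R in
    let N : rat := n%:R in
    (x = 0 %[mod 6] -> N = (X ^+ 3 + 12 * X ^+ 2 + 12 * X) / 72) /\
    (x = 1 %[mod 6] -> N = (X ^+ 3 + 12 * X ^+ 2 + 3 * X - 16) / 72) /\
    (x = 2 %[mod 6] -> N = (X ^+ 3 + 12 * X ^+ 2 + 12 * X - 8) / 72) /\
    (x = 3 %[mod 6] -> N = (X ^+ 3 + 12 * X ^+ 2 + 3 * X) / 72) /\
    (x = 4 %[mod 6] -> N = (X ^+ 3 + 12 * X ^+ 2 + 12 * X - 16) / 72) /\
    (x = 5 %[mod 6] -> N = (X ^+ 3 + 12 * X ^+ 2 + 3 * X - 8) / 72).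
Proof.
exists (size (metacyclic_params x)); split; first exact: powerful_rank2_isog_classes.
move=> X N.
do 5?[split].
(* The counting identity in the naturals is cast to [rat], where the formula for each residue
   follows linearly. *)
all: move/card_metacyclic_params => /(_ isT) /(congr1 (fun k => k%:R : rat)) /=.
all: rewrite !natrD !natrM ?natrX -/X -/N; lra.
Qed.
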